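(* Let $G$ be a countably infinite (discrete) group. If $A,B\subseteq G$ are not nice vdC, then $A\cup B$ is not nice vdC.
   Context: A measure-preserving system (m.p.s.) $(X,\mathscr{B},\mu,(T_g)_{g\in G})$ consists of a standard probability space $(X,\mathscr{B},\mu)$ and a measure-preserving action $T$ of $G$ on it. A set $R\subseteq G$ is nice vdC if for every m.p.s. $(X,\mathscr{B},\mu,(T_g)_{g\in G})$, every complex-valued $f\in L^\infty(X,\mu)$, and every $\varepsilon>0$, there is $r\in R$ such that $\left|\int_X f(T_{r^{-1}}x)\overline{f(x)}\,d\mu(x)\right|\geq\left|\int_X f\,d\mu\right|^2-\varepsilon$. *)

(* Defs.v *)
From HB Require Import structures.
From mathcomp Require Import all_boot all_order all_algebra.
From mathcomp Require Import complex.
From mathcomp Require Import all_classical all_reals all_analysis.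
From mathcomp Require Import ess_sup_inf.
Set Implicit Arguments.
Unset Strict Implicit.
Unset Printing Implicit Defensive.
Import Order.TTheory GRing.Theory Num.Theory.
Import numFieldNormedType.Exports.
Local Open Scope classical_set_scope.
Local Open Scope ring_scope.

(* A Hausdorff pseudometric is a metric. *)
Definition polish (R : realType) (P : completePseudoMetricType R) : Prop :=
  hausdorff_space P /\ exists2 D : set P, countable D & dense D.

(* iota identifies the sigma-algebra of X with the Borel sigma-algebra of P. *)
Definition standard_borel (R : realType) (d : measure_display)
    (X : measurableType d) : Prop :=
  exists (P : completePseudoMetricType R) (iota : X -> P),
    [/\ polish P, bijective iota &
        forall A : set X, measurable A <->
          exists2 U : set P, <<s [set O : set P | open O] >> U &
                             A = iota @^-1` U].

Definition mp_action (R : realType) (G : groupType) (d : measure_display)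
    (X : measurableType d) (mu : probability X R) (T : G -> X -> X) : Prop :=
  [/\ forall x, T 1%g x = x,
      forall g h x, T (g * h)%g x = T g (T h x),
      forall g, measurable_fun [set: X] (T g) &
      forall g (A : set X), measurable A -> mu (T g @^-1` A) = mu A].

(* X, mu, T form an m.p.s.: the probability space is standard, in the sense of
   a Borel probability measure on a standard Borel space. *)
Definition mps (R : realType) (G : groupType) (d : measure_display)
    (X : measurableType d) (mu : probability X R) (T : G -> X -> X) : Prop :=
  standard_borel R X /\ mp_action mu T.

(* The norm of R[i] takes its (real) values in R[i], whence the outer Re. *)
Definition Linfty_complex (R : realType) (d : measure_display)
    (X : measurableType d) (mu : probability X R) (f : X -> R[i]) : Prop :=
  [/\ measurable_fun [set: X] (fun x => complex.Re (f x)),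
      measurable_fun [set: X] (fun x => complex.Im (f x)) &
      (ess_sup mu (fun x => (complex.Re `|f x|)%:E) < +oo)%E].

Definition integral_complex (R : realType) (d : measure_display)
    (X : measurableType d) (mu : probability X R) (f : X -> R[i]) : R[i] :=
  Complex (Rintegral mu [set: X] (fun x => complex.Re (f x)))
          (Rintegral mu [set: X] (fun x => complex.Im (f x))).

(* The inequality is between real elements of R[i], where the order compares
   real parts and requires equal imaginary parts. *)
Definition nice_vdC (R : realType) (G : groupType) (S : set G) : Prop :=
  forall (d : measure_display) (X : measurableType d) (mu : probability X R)
    (T : G -> X -> X) (f : X -> R[i]) (eps : R),
  mps mu T -> Linfty_complex mu f -> 0 < eps ->
  exists2 r : G, S r &
    `|integral_complex mu (fun x => f (T (r^-1)%g x) * conjc (f x))|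
      >= `|integral_complex mu f| ^+ 2 - (eps%:C)%C.

(* Main.v *)
(** Call phi : G -> R a centered correlation if phi r is the correlation of f
    with f o T_{r^-1} for a bounded real f of mean 0 on an m.p.s.  A set S is
    not nice vdC iff some centered correlation phi satisfies
    |1 + phi| <= 1 - e on S for some e > 0: normalize the mean of f to 1 and
    take real parts.

    Product systems show that centered correlations are stable under sums,
    nonnegative multiples and (phi, psi) |-> (1 + phi) psi.  Multiplying the
    functions 1 + phi and 1 + psi of A and B is not enough, as 1 + psi may be
    large on A.  Instead let
      w = psi ((1 + phi)^m + k) + phi ((1 + psi)^m + k)
    with m even and k small.  On A we have phi <= - e, and (1 + phi)^m is
    negligible for large m.  If psi <= 0 both terms are nonpositive and the
    second one is at most - e k; if psi >= 0 the second one is at most - e and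
    dominates the first, which is small.  By symmetry w is uniformly negative
    on the union of A and B, and so 1 + s w is nonnegative and bounded away
    from 1 there for s > 0 small. *)
From HB Require Import structures.
Require Import Defs.
From mathcomp Require Import all_boot all_order all_algebra.
From mathcomp Require Import complex.
From mathcomp Require Import all_classical all_reals all_analysis.
From mathcomp Require Import measurable_realfun ess_sup_inf ring lra.
Set Implicit Arguments.
Unset Strict Implicit.
Unset Printing Implicit Defensive.
Import Order.TTheory GRing.Theory Num.Theory.
Import numFieldNormedType.Exports.
Local Open Scope classical_set_scope.
Local Open Scope ring_scope.

(** * Products of standard Borel spaces *)

(* The library leaves out the joins of the uniform and pseudometric structures
   of a product with its pointed structure. *)
HB.saturate prod.

Section prod_complete.
Context {U V : completeType}.

(** Pairing an entourage of one factor with the full entourage of the other shows that both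
    projections of [F] are Cauchy; the pair of their limits is a limit of [F]. *)
Lemma prod_cauchy_cvg (F : set_system (U * V)) :
  ProperFilter F -> cauchy F -> cvg F.
Proof.
move=> FF cF.
have cU : cauchy (fst @ F).
  move=> A entA.
  have := cF _ (prod_entP entA (@filterT _ entourage _)).
  by move=> [[P Q] [/= FP FQ] PQ]; exists (fst @` P, fst @` Q) => /=;
    [split; [move: FP|move: FQ]; apply: filterS => x ?; exists x
    |move=> [_ _] /= [[x Px <-] [y Qy <-]]; have [] := PQ (x, y) (conj Px Qy)].
have cV : cauchy (snd @ F).
  move=> A entA.
  have := cF _ (prod_entP (@filterT _ entourage _) entA).
  by move=> [[P Q] [/= FP FQ] PQ]; exists (snd @` P, snd @` Q) => /=;
    [split; [move: FP|move: FQ]; apply: filterS => x ?; exists x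
    |move=> [_ _] /= [[x Px <-] [y Qy <-]]; have [] := PQ (x, y) (conj Px Qy)].
have Fa := cauchy_cvg _ cU.
have Fb := cauchy_cvg _ cV.
apply/cvg_ex; exists (lim (fst @ F), lim (snd @ F)) => W [[P Q] /= [aP bQ] PQW].
by apply: filterS PQW _; apply: filterI; [exact: Fa _ aP|exact: Fb _ bQ].
Qed.

HB.instance Definition _ :=
  Uniform_isComplete.Build (U * V)%type prod_cauchy_cvg.

End prod_complete.

HB.saturate prod.

Section polish_prod.
Context {R : realType} {P Q : completePseudoMetricType R}.

Lemma nbhs_setX (p : P) (q : Q) (A : set P) (B : set Q) :
  nbhs p A -> nbhs q B -> nbhs (p, q) (A `*` B).
Proof. by move=> pA qB; exists (A, B). Qed.

Lemma prod_hausdorff : hausdorff_space P -> hausdorff_space Q ->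
  hausdorff_space (P * Q)%type.
Proof.
move=> hP hQ [p q] [p' q'] cl; congr (_, _).
  apply: hP => A B pA pB.
  have [[x y] [[/= Ax _] [/= Bx _]]] :=
    cl _ _ (nbhs_setX pA filterT) (nbhs_setX pB filterT).
  by exists x.
apply: hQ => A B pA pB.
have [[x y] [[/= _ Ay] [/= _ By]]] :=
  cl _ _ (nbhs_setX filterT pA) (nbhs_setX filterT pB).
by exists y.
Qed.

Lemma dense_prod (D : set P) (E : set Q) :
  dense D -> dense E -> dense (D `*` E).
Proof.
move=> dD dE O [[p q] Opq] oO.
have [[A B] /= [pA qB] AB] : nbhs (p, q) O by exact: open_nbhs_nbhs.
have [x [Ax Dx]] : A° `&` D !=set0.
  by apply: dD (open_interior _); exists p; exact: pA.
have [y [By Ey]] : B° `&` E !=set0.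
  by apply: dE (open_interior _); exists q; exact: qB.
exists (x, y); split => //; apply: AB.
by split => /=; apply: interior_subset.
Qed.

Lemma polish_prod : polish P -> polish Q -> @polish R (P * Q)%type.
Proof.
move=> [hP [D cD dD]] [hQ [E cE dE]]; split; first exact: prod_hausdorff.
by exists (D `*` E); [exact: countableX|exact: dense_prod].
Qed.
End polish_prod.

Section standard_borel_prod.
Context {R : realType} d1 d2 (X : measurableType d1) (Y : measurableType d2).

(** Separability makes every open set of [P * Q] a countable union of open rectangles, and preimages
    of rectangles are measurable rectangles of [X * Y]. *)
Lemma open_preimage_prod (P Q : completePseudoMetricType R)
    (i : X -> P) (j : Y -> Q) (D : set P) (E : set Q) :
  countable D -> dense D -> countable E -> dense E ->
  (forall U, open U -> measurable (i @^-1` U)) ->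
  (forall U, open U -> measurable (j @^-1` U)) ->
  forall O : set (P * Q), open O ->
    measurable [set xy : X * Y | O (i xy.1, j xy.2)].
Proof.
move=> cD dD cE dE mi mj O oO.
pose r n : R := n.+1%:R^-1.
have r_gt0 n : 0 < r n by rewrite invr_gt0.
(* A triple (p, q, n) stands for the ball around the point (p, q) of the dense set, of radius [r n];
   only balls inside [O] are kept. *)
pose I := [set t : P * Q * nat | (D `*` E) t.1 /\ ball t.1 (r t.2) `<=` O].
have cI : countable I.
  apply: (@sub_countable _ _ _ ((D `*` E) `*` [set: nat])).
    by apply: subset_card_le => t [].
  by apply: countableX => //; exact: countableX.
pose F (t : P * Q * nat) : set (X * Y) :=
  (i @^-1` (ball t.1.1 (r t.2))°) `*` (j @^-1` (ball t.1.2 (r t.2))°).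
rewrite (_ : mkset _ = \bigcup_(t in I) F t).
  rewrite bigcup_set_type; apply: countable_bigcupT_measurable.
    by rewrite (eq_countable (card_setT _)).
  move=> t; apply: measurableX; [exact: mi (open_interior _)|].
  exact: mj (open_interior _).
apply/seteqP; split => [[x y] /= Oxy|[x y] [[[p q] n] [/= _ sub] [/= Fx Fy]]].
  have /nbhs_ballP[e /= e0 eO] : nbhs (i x, j y) O by exact: open_nbhs_nbhs.
  (* The center is taken within [r n / 2] of the point, so its ball of radius [r n] reaches at most
     [3 / 2 * r n < e] away from the point. *)
  have [n ne] : exists n, r n < e / 2.
    have := @ltr_add_invr R 0 (e / 2); rewrite divr_gt0//.
    by move=> /(_ isT)[n]; rewrite add0r => ?; exists n.
  have r2_gt0 : 0 < r n / 2 by rewrite divr_gt0.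
  have [p [/interior_subset xp Dp]] : (ball (i x) (r n / 2))° `&` D !=set0.
    by apply: dD (open_interior _); exists (i x); exact: nbhsx_ballx.
  have [q [/interior_subset yq Eq]] : (ball (j y) (r n / 2))° `&` E !=set0.
    by apply: dE (open_interior _); exists (j y); exact: nbhsx_ballx.
  have ball_int (S : completePseudoMetricType R) (a b : S) :
      ball a (r n / 2) b -> (ball b (r n))° a.
    move=> ab; apply/nbhs_ballP; exists (r n / 2) => //= z az.
    by rewrite (splitr (r n)); apply: ball_triangle az; exact: ball_sym.
  exists (p, q, n); last by split; exact: ball_int.
  split => //= -[z w] [/= pz qw]; apply: eO.
  have re : r n / 2 + r n <= e by move: ne (r_gt0 n); lra.
  split => /=; apply: (le_ball re).
    exact: ball_triangle xp pz.
  exact: ball_triangle yq qw.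
apply: sub; split; exact: interior_subset.
Qed.

(** The product sigma-algebra corresponds to the Borel sets of [P * Q]: one inclusion is
    [open_preimage_prod], the other is continuity of the projections. *)
Lemma standard_borel_prod :
  standard_borel R X -> standard_borel R Y ->
  standard_borel R (X * Y)%type.
Proof.
move=> [P [i [pP [i' ii' i'i] mX]]] [Q [j [pQ [j' jj' j'j] mY]]].
pose ij (xy : X * Y) : P * Q := (i xy.1, j xy.2).
have [hP [D cD dD]] := pP; have [hQ [E cE dE]] := pQ.
exists (P * Q)%type, ij; split; first exact: polish_prod.
  exists (fun pq => (i' pq.1, j' pq.2)) => [[x y]|[p q]] /=.
    by rewrite ii' jj'.
  by rewrite /ij /= i'i j'j.
have mi : measurable_fun setT
    (ij : X * Y -> g_sigma_algebraType (@open (P * Q)%type)).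
  apply: (@measurability _ _ (X * Y)%type
    (g_sigma_algebraType (@open (P * Q)%type))
    setT ij (@open (P * Q)%type) erefl) => _ [W oW <-]; rewrite setTI.
  refine (@open_preimage_prod _ _ i j _ _ cD dD cE dE _ _ _ oW) => U oU.
    by apply/mX; exists U => //; exact: sub_sigma_algebra.
  by apply/mY; exists U => //; exact: sub_sigma_algebra.
move=> A; split => [mA|[U mU ->]]; last first.
  by have := mi measurableT U mU; rewrite setTI.
(* The product sigma-algebra is generated by the preimages of measurable sets under [fst] and [snd],
   so only these have to be traced back to Borel sets. *)
suff : g_sigma_preimageU (@fst X Y) (@snd X Y) `<=`
    preimage_set_system setT ij <<s (@open (P * Q)%type) >>.
  by move=> /(_ _ mA)[U mU <-]; exists U => //; rewrite setTI.
apply: smallest_sub.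
  exact/sigma_algebra_preimage/smallest_sigma_algebra.
have fstB : measurable_fun setT
    (fst : g_sigma_algebraType (@open (P * Q)%type) ->
           g_sigma_algebraType (@open P)).
  apply: (@measurability _ _ (g_sigma_algebraType (@open (P * Q)%type))
    (g_sigma_algebraType (@open P)) setT fst (@open P) erefl) => // _ [W oW <-].
  rewrite setTI; apply: sub_sigma_algebra.
  by apply: open_comp oW => z _; exact: cvg_fst.
have sndB : measurable_fun setT
    (snd : g_sigma_algebraType (@open (P * Q)%type) ->
           g_sigma_algebraType (@open Q)).
  apply: (@measurability _ _ (g_sigma_algebraType (@open (P * Q)%type))
    (g_sigma_algebraType (@open Q)) setT snd (@open Q) erefl) => // _ [W oW <-].
  rewrite setTI; apply: sub_sigma_algebra.
  by apply: open_comp oW => z _; exact: cvg_snd.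
move=> _ [|] [B mB <-]; rewrite setTI.
  have [U mU ->] := (mX B).1 mB.
  exists (fst @^-1` U); last by rewrite setTI.
  by have := fstB measurableT U mU; rewrite setTI.
have [U mU ->] := (mY B).1 mB.
exists (snd @^-1` U); last by rewrite setTI.
by have := sndB measurableT U mU; rewrite setTI.
Qed.

End standard_borel_prod.

(** * Products of measure-preserving systems *)

(** The bound holds everywhere, not just almost everywhere, so that it passes pointwise to products
    and translates; [ae_bounded_measurable] reduces essentially bounded functions to this case. *)
Definition bounded_measurable (R : realType) d (X : measurableType d)
    (f : X -> R) : Prop :=
  measurable_fun [set: X] f /\ exists M, forall x, `|f x| <= M.

Section bounded_measurable.
Context {R : realType} d (X : measurableType d).
Implicit Types f g : X -> R.

Lemma bounded_measurable_cst c : bounded_measurable (fun _ : X => c : R).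
Proof. by split; [exact: measurable_cst|exists `|c|]. Qed.

Lemma bounded_measurableD f g : bounded_measurable f -> bounded_measurable g ->
  bounded_measurable (fun x => f x + g x).
Proof.
move=> [mf [M fM]] [mg [N gN]]; split; first exact: measurable_funD.
by exists (M + N) => x; rewrite (le_trans (ler_normD _ _))// lerD.
Qed.

Lemma bounded_measurableM f g : bounded_measurable f -> bounded_measurable g ->
  bounded_measurable (fun x => f x * g x).
Proof.
move=> [mf [M fM]] [mg [N gN]]; split; first exact: measurable_funM.
by exists (M * N) => x; rewrite normrM ler_pM.
Qed.

Lemma bounded_measurable_comp d' (Y : measurableType d') (h : Y -> X) f :
  measurable_fun setT h -> bounded_measurable f ->
  bounded_measurable (fun y => f (h y)).
Proof.
move=> mh [mf [M fM]]; split; first exact: measurableT_comp.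
by exists M.
Qed.

Lemma bounded_measurable_integrable (mu : probability X R) f :
  bounded_measurable f -> mu.-integrable setT (EFin \o f).
Proof.
move=> [mf [M fM]]; apply: measurable_bounded_integrable => //.
  by rewrite -ge0_fin_numE// fin_num_measure.
exists M; split; first exact: num_real.
by move=> N MN x _; exact: le_trans (fM x) (ltW MN).
Qed.

End bounded_measurable.
Arguments bounded_measurable_cst {R d X} c.

Section bounded_integral.
Context {R : realType} d (X : measurableType d) (mu : probability X R).
Implicit Types f g : X -> R.

Lemma bounded_RintegralD f g : bounded_measurable f -> bounded_measurable g ->
  \int[mu]_x (f x + g x) = \int[mu]_x f x + \int[mu]_x g x.
Proof.
by move=> bf bg; rewrite RintegralD//; exact: bounded_measurable_integrable.
Qed.

Lemma bounded_RintegralZ c f : bounded_measurable f ->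
  \int[mu]_x (c * f x) = c * \int[mu]_x f x.
Proof.
by move=> bf; rewrite RintegralZl//; exact: bounded_measurable_integrable.
Qed.

Lemma probability_Rintegral_cst c : \int[mu]_x c = c.
Proof.
rewrite Rintegral_cst// -[RHS]mulr1; congr (_ * _).
by rewrite -[RHS]/(fine 1%E) -(probability_setT mu).
Qed.

Lemma ae_eq_Rintegral f g : measurable_fun setT f -> measurable_fun setT g ->
  {ae mu, forall x, f x = g x} -> \int[mu]_x f x = \int[mu]_x g x.
Proof.
move=> mf mg fg; congr fine; apply: ae_eq_integral => //.
- exact/measurable_EFinP.
- exact/measurable_EFinP.
- by apply: filterS fg => x -> .
Qed.

End bounded_integral.

Section mps_prod.
Context {R : realType} (G : groupType) d1 d2 (X : measurableType d1)
  (Y : measurableType d2) (mu : probability X R) (nu : probability Y R).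

Lemma Rintegral_prod (f : X -> R) (g : Y -> R) :
  bounded_measurable f -> bounded_measurable g ->
  \int[(mu \x nu)%E : probability (X * Y)%type R]_z (f z.1 * g z.2) =
  \int[mu]_x f x * \int[nu]_y g y.
Proof.
move=> bf bg.
have bfg : bounded_measurable (fun z : X * Y => f z.1 * g z.2).
  by apply: bounded_measurableM; apply: bounded_measurable_comp.
rewrite /Rintegral -integral12_prod_meas1; last first.
  exact: (@bounded_measurable_integrable _ _ _ (mu \x nu)%E).
rewrite [X in fine X](_ : _ = \int[mu]_x ((\int[nu]_y g y)%:E * (f x)%:E))%E.
  rewrite integralZl//; last exact: bounded_measurable_integrable.
  by rewrite mulrC -fineM ?fineK//;
    apply: integrable_fin_num => //; exact: bounded_measurable_integrable.
apply: eq_integral => x _; rewrite /fubini_F /=.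
under eq_integral do rewrite EFinM.
rewrite integralZl//; last exact: bounded_measurable_integrable.
rewrite muleC /Rintegral fineK//.
by apply: integrable_fin_num => //; exact: bounded_measurable_integrable.
Qed.

Lemma mp_action_prod (T : G -> X -> X) (S : G -> Y -> Y) :
  mp_action mu T -> mp_action nu S ->
  mp_action (mu \x nu)%E (fun g (z : X * Y) => (T g z.1, S g z.2)).
Proof.
move=> [T1 TM mT muT] [S1 SM mS nuS].
have mTS g : measurable_fun setT (fun z : X * Y => (T g z.1, S g z.2)).
  by apply: measurable_fun_pair; apply: measurableT_comp.
split => //.
- by move=> [x y] /=; rewrite T1 S1.
- by move=> g h [x y] /=; rewrite TM SM.
- move=> g A mA.
  (* The pushforward of the product measure has the right values on rectangles, hence equals the
     product measure by uniqueness. *)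
  pose TS (z : X * Y) := (T g z.1, S g z.2).
  have mTSg : measurable_fun setT TS := mTS g.
  pose TS_mfun := isMeasurableFun.Build _ _ _ _ _ mTSg.
  pose TSm : {mfun _ >-> _} := HB.pack TS TS_mfun.
  apply/esym; rewrite -[RHS]/(pushforward (mu \x nu)%E TSm A).
  apply: (@product_measure_unique _ _ _ _ _ mu nu
    (pushforward (mu \x nu)%E TSm)) => // B C mB mC.
  transitivity ((mu \x nu)%E ((T g @^-1` B) `*` (S g @^-1` C))) => //.
  rewrite product_measure1E//.
  + by congr (_ * _)%E; [exact: muT|exact: nuS].
  + by rewrite -[X in measurable X]setTI; exact: mT.
  + by rewrite -[X in measurable X]setTI; exact: mS.
Qed.

Lemma mps_prod (T : G -> X -> X) (S : G -> Y -> Y) :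
  mps mu T -> mps nu S ->
  mps (mu \x nu)%E (fun g (z : X * Y) => (T g z.1, S g z.2)).
Proof.
by move=> [? ?] [? ?]; split;
  [exact: standard_borel_prod|exact: mp_action_prod].
Qed.

End mps_prod.

(** * Centered correlations *)

Section centered_correlation.
Context {R : realType} {G : groupType}.
Implicit Types (phi psi : G -> R) (g r : G).

Definition centered_correlation phi : Prop :=
  exists d (X : measurableType d) (mu : probability X R) (T : G -> X -> X)
    (f : X -> R),
  [/\ mps mu T, bounded_measurable f, \int[mu]_x f x = 0 &
      forall r, phi r = \int[mu]_x (f (T r^-1%g x) * f x)].

Lemma bounded_measurable_act d (X : measurableType d) (mu : probability X R)
    (T : G -> X -> X) g (f : X -> R) : mp_action mu T ->
  bounded_measurable f -> bounded_measurable (fun x => f (T g x)).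
Proof. by move=> [_ _ mT _]; exact: bounded_measurable_comp. Qed.

Lemma Rintegral_act d (X : measurableType d) (mu : probability X R)
    (T : G -> X -> X) g (f : X -> R) : mp_action mu T ->
  bounded_measurable f -> \int[mu]_x f (T g x) = \int[mu]_x f x.
Proof.
move=> Tmp bf; have [_ _ mT muT] := Tmp.
pose Tg_mfun := isMeasurableFun.Build _ _ _ _ _ (mT g).
pose Tg : {mfun _ >-> _} := HB.pack (T g) Tg_mfun.
congr fine; transitivity (\int[pushforward mu Tg]_x (f x)%:E)%E.
  rewrite integral_pushforward//.
  - by apply/measurable_EFinP; case: bf.
  - rewrite preimage_setT.
    exact: bounded_measurable_integrable (bounded_measurable_act g Tmp bf).
apply: eq_measure_integral => A mA _; exact: muT.
Qed.

(** The exceptional null set pulls back to a null set. This carries an almost everywhere equality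
    over to translates. *)
Lemma ae_act d (X : measurableType d) (mu : probability X R)
    (T : G -> X -> X) g (P : set X) : mp_action mu T ->
  {ae mu, forall x, P x} -> {ae mu, forall x, P (T g x)}.
Proof.
move=> [_ _ mT muT] [N [mN N0 PN]]; exists (T g @^-1` N); split.
- by rewrite -[X in measurable X]setTI; exact: mT.
- by rewrite muT.
- by move=> x /= nPx; exact: PN.
Qed.

Lemma centered_correlation_bounded phi : centered_correlation phi ->
  exists2 M, 0 <= M & forall r, `|phi r| <= M.
Proof.
move=> [d [X [mu [T [f [[_ Tmp] bf _ phiE]]]]]].
have [_ [M fM]] := bf; exists (M * M); first by rewrite -expr2 sqr_ge0.
move=> r; rewrite phiE.
have bff := bounded_measurableM (bounded_measurable_act r^-1%g Tmp bf) bf.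
have iff := @bounded_measurable_integrable _ _ _ mu _ bff.
rewrite (le_trans (le_normr_Rintegral _ iff))//.
rewrite -[leRHS](probability_Rintegral_cst mu).
apply: le_Rintegral => //.
- exact: integrable_norm iff.
- exact: bounded_measurable_integrable (bounded_measurable_cst _).
- by move=> x _; rewrite normrM ler_pM.
Qed.

Lemma centered_correlationZ c phi : 0 <= c ->
  centered_correlation phi -> centered_correlation (fun r => c * phi r).
Proof.
move=> c0 [d [X [mu [T [f [mT bf f0 phiE]]]]]].
(* Correlations are quadratic in the function, hence the square root. *)
exists d, X, mu, T, (fun x => Num.sqrt c * f x); split => //.
- exact: bounded_measurableM (bounded_measurable_cst _) bf.
- by rewrite bounded_RintegralZ// f0 mulr0.
move=> r; rewrite phiE -bounded_RintegralZ; last first.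
  exact: bounded_measurableM (bounded_measurable_act r^-1%g mT.2 bf) bf.
congr Rintegral; apply/funext => x.
by rewrite mulrACA -expr2 sqr_sqrtr.
Qed.

(** The function f(x) + g(y) on the product system works: its cross terms integrate to products
    containing a zero mean. The factors 1 in the witness bring each summand into the form of
    [Rintegral_prod]. *)
Lemma centered_correlationD phi psi :
  centered_correlation phi -> centered_correlation psi ->
  centered_correlation (fun r => phi r + psi r).
Proof.
move=> [d [X [mu [T [f [mT bf f0 phiE]]]]]].
move=> [d' [Y [nu [S [g [mS bg g0 psiE]]]]]].
have bfT r := bounded_measurable_act r mT.2 bf.
have bgS r := bounded_measurable_act r mS.2 bg.
have bc1 : bounded_measurable (fun _ : X => 1 : R) := bounded_measurable_cst _.
have bc2 : bounded_measurable (fun _ : Y => 1 : R) := bounded_measurable_cst _.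
have bprod u v : bounded_measurable u -> bounded_measurable v ->
    bounded_measurable (fun z : X * Y => (u z.1 : R) * v z.2).
  by move=> bu bv; apply: bounded_measurableM; apply: bounded_measurable_comp.
exists _, (X * Y)%type, (mu \x nu)%E,
  (fun g z => (T g z.1, S g z.2)), (fun z => f z.1 * 1 + 1 * g z.2); split.
- exact: mps_prod.
- exact: bounded_measurableD (bprod _ _ bf bc2) (bprod _ _ bc1 bg).
- rewrite bounded_RintegralD;
    [|exact: bprod _ _ bf bc2|exact: bprod _ _ bc1 bg].
  by rewrite (Rintegral_prod _ _ bf bc2) (Rintegral_prod _ _ bc1 bg) f0 g0
    mulr0 mul0r addr0.
move=> r /=.
transitivity (\int[(mu \x nu)%E : probability (X * Y)%type R]_z
   ((((f (T r^-1%g z.1) * f z.1) * 1 + 1 * (g (S r^-1%g z.2) * g z.2)) +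
     f (T r^-1%g z.1) * g z.2) + f z.1 * g (S r^-1%g z.2))); last first.
  by congr Rintegral; apply/funext => z; ring.
have bff := bprod _ _ (bounded_measurableM (bfT r^-1%g) bf) bc2.
have bgg := bprod _ _ bc1 (bounded_measurableM (bgS r^-1%g) bg).
have bfg := bprod _ _ (bfT r^-1%g) bg.
have bgf := bprod _ _ bf (bgS r^-1%g).
rewrite bounded_RintegralD;
  [|exact: bounded_measurableD (bounded_measurableD bff bgg) bfg|exact: bgf].
rewrite bounded_RintegralD; [|exact: bounded_measurableD bff bgg|exact: bfg].
rewrite bounded_RintegralD; [|exact: bff|exact: bgg].
rewrite (Rintegral_prod _ _ (bounded_measurableM (bfT r^-1%g) bf) bc2).
rewrite (Rintegral_prod _ _ bc1 (bounded_measurableM (bgS r^-1%g) bg)).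
rewrite (Rintegral_prod _ _ (bfT r^-1%g) bg).
rewrite (Rintegral_prod _ _ bf (bgS r^-1%g)).
rewrite -phiE -psiE f0 g0 !probability_Rintegral_cst.
by rewrite mulr1 mul1r mulr0 mul0r !addr0.
Qed.

(** The witness is (1 + f(x)) g(y): the mean vanishes because of g, and 1 + f has correlation
    [1 + phi] because f has mean 0. *)
Lemma centered_correlationM1D phi psi :
  centered_correlation phi -> centered_correlation psi ->
  centered_correlation (fun r => (1 + phi r) * psi r).
Proof.
move=> [d [X [mu [T [f [mT bf f0 phiE]]]]]].
move=> [d' [Y [nu [S [g [mS bg g0 psiE]]]]]].
have bfT r := bounded_measurable_act r mT.2 bf.
have bgS r := bounded_measurable_act r mS.2 bg.
have bc1 : bounded_measurable (fun _ : X => 1 : R) := bounded_measurable_cst _.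
have b1f := bounded_measurableD bc1 bf.
exists _, (X * Y)%type, (mu \x nu)%E,
  (fun g z => (T g z.1, S g z.2)), (fun z => (1 + f z.1) * g z.2); split.
- exact: mps_prod.
- exact: bounded_measurableM (bounded_measurable_comp measurable_fst b1f)
    (bounded_measurable_comp measurable_snd bg).
- by rewrite (Rintegral_prod _ _ b1f bg) g0 mulr0.
move=> r /=.
have b1fT := bounded_measurableD bc1 (bfT r^-1%g).
transitivity (\int[(mu \x nu)%E : probability (X * Y)%type R]_z
   (((1 + f (T r^-1%g z.1)) * (1 + f z.1)) * (g (S r^-1%g z.2) * g z.2)));
    last first.
  by congr Rintegral; apply/funext => z; ring.
rewrite (Rintegral_prod _ _ (bounded_measurableM b1fT b1f)
  (bounded_measurableM (bgS r^-1%g) bg)).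
rewrite -psiE; congr (_ * _).
transitivity (\int[mu]_x
   ((1 + f x) + (f (T r^-1%g x) + f (T r^-1%g x) * f x))); last first.
  by congr Rintegral; apply/funext => x; ring.
have bff := bounded_measurableM (bfT r^-1%g) bf.
rewrite bounded_RintegralD//; last exact: bounded_measurableD.
rewrite !bounded_RintegralD// -phiE (Rintegral_act _ mT.2 bf) f0.
by rewrite probability_Rintegral_cst addr0 add0r.
Qed.

(** Subtracting the mean c from f adds [- 2 * c ^+ 2 + c ^+ 2] to the correlation, as translates
    have the same mean. *)
Lemma centered_correlation_center d (X : measurableType d)
    (mu : probability X R) (T : G -> X -> X) (f : X -> R) :
  mps mu T -> bounded_measurable f ->
  centered_correlation
    (fun r => \int[mu]_x (f (T r^-1%g x) * f x) - (\int[mu]_x f x) ^+ 2).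
Proof.
move=> mT bf; set c := \int[mu]_x f x.
have bcf a : bounded_measurable (fun x => a * f x).
  exact: bounded_measurableM (bounded_measurable_cst _) bf.
exists d, X, mu, T, (fun x => f x + - c); split => //.
- exact: bounded_measurableD bf (bounded_measurable_cst _).
- rewrite bounded_RintegralD//; last exact: bounded_measurable_cst.
  by rewrite probability_Rintegral_cst subrr.
move=> r; have bfT := bounded_measurable_act r^-1%g mT.2 bf.
have bff := bounded_measurableM bfT bf.
have bcfT : bounded_measurable (fun x => - c * f (T r^-1%g x)).
  exact: bounded_measurableM (bounded_measurable_cst _) bfT.
transitivity (\int[mu]_x (f (T r^-1%g x) * f x +
    ((- c * f (T r^-1%g x) + - c * f x) + c ^+ 2))); last first.
  by congr Rintegral; apply/funext => x; ring.
rewrite bounded_RintegralD//; last first.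
  exact: bounded_measurableD (bounded_measurableD _ _)
    (bounded_measurable_cst _).
rewrite bounded_RintegralD;
  [|exact: bounded_measurableD|exact: bounded_measurable_cst].
rewrite bounded_RintegralD// (bounded_RintegralZ _ _ bfT).
rewrite (bounded_RintegralZ _ _ bf) (Rintegral_act _ mT.2 bf).
by rewrite probability_Rintegral_cst -/c; ring.
Qed.

End centered_correlation.

(** * A centered correlation for the union of two sets *)

Section combination.
Context {R : realType}.

(** Here x and y are the values of [phi] and [psi] at a point of A; on B the same estimate serves
    with the roles exchanged. *)
Lemma combination_neg (x y e N k : R) (m : nat) : ~~ odd m ->
  0 < e -> 0 < k -> k <= 2^-1 -> 4 * (N * k) <= e ->
  `|1 + x| <= 1 - e -> (1 - e) ^+ m <= k -> `|y| <= N ->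
  y * ((1 + x) ^+ m + k) + x * ((1 + y) ^+ m + k) <= - (e * k).
Proof.
move=> evm e0 k0 k2 Nk x1 ek yN.
have xe : x <= - e by move: x1 (ler_norm (1 + x)); lra.
have p0 : 0 <= (1 + x) ^+ m by rewrite exprn_even_ge0.
have q0 : 0 <= (1 + y) ^+ m by rewrite exprn_even_ge0.
have pk : (1 + x) ^+ m <= k.
  rewrite (le_trans (ler_norm _))// normrX (le_trans _ ek)//.
  by rewrite lerXn2r ?nnegrE// (le_trans _ x1).
have [y0|/ltW y0] := leP y 0.
  have : y * ((1 + x) ^+ m + k) <= 0 by rewrite mulr_le0_ge0// addr_ge0// ltW.
  have : x * ((1 + y) ^+ m + k) <= - e * k.
    apply: (@le_trans _ _ (x * k)).
      by rewrite ler_wnM2l ?lerDr//; lra.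
    by rewrite ler_wpM2r// ltW.
  by lra.
(* For y >= 0 the second term is at most - e and the first at most 2 N k <= e / 2; the sum is at
   most - e / 2 <= - e k, since k <= 1 / 2. *)
have q1 : 1 <= (1 + y) ^+ m by rewrite exprn_ege1// lerDl.
have : y * ((1 + x) ^+ m + k) <= N * (k + k).
  have yleN : y <= N by rewrite (le_trans (ler_norm y)).
  by rewrite ler_pM ?lerD2r// addr_ge0// ltW.
have : x * ((1 + y) ^+ m + k) <= - e * 1.
  apply: (@le_trans _ _ (x * 1)).
    by rewrite ler_wnM2l//; lra.
  by rewrite ler_wpM2r.
have : e * k <= e / 2 by rewrite ler_wpM2l// ltW.
by lra.
Qed.

Lemma exists_even_exprn_le (x k : R) : 0 <= x < 1 -> 0 < k ->
  exists2 m, ~~ odd m & x ^+ m <= k.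
Proof.
move=> /andP[x0 x1] k0.
have /cvgrPdist_le/(_ _ k0) : x ^+ n @[n --> \oo] --> (0 : R).
  by apply: cvg_expr; rewrite ger0_norm.
move=> [n _ nk]; exists n.*2; first by rewrite odd_double.
have /nk : (n <= n.*2)%N by rewrite -addnn leq_addr.
by rewrite /= sub0r normrN; apply: le_trans; exact: ler_norm.
Qed.

Context {G : groupType}.
Implicit Types (phi psi : G -> R).

Lemma centered_correlation_exprM phi psi m : centered_correlation phi ->
  centered_correlation psi ->
  centered_correlation (fun r => (1 + phi r) ^+ m * psi r).
Proof.
move=> cphi cpsi; elim: m => [|m IH].
  by under eq_fun do rewrite expr0 mul1r.
under eq_fun do rewrite exprS -mulrA.
exact: centered_correlationM1D.
Qed.

Lemma centered_correlation_union (A B : set G) phi psi (e : R) :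
  centered_correlation phi -> centered_correlation psi -> 0 < e -> e <= 1 ->
  (forall r, A r -> `|1 + phi r| <= 1 - e) ->
  (forall r, B r -> `|1 + psi r| <= 1 - e) ->
  exists theta (e' : R), [/\ centered_correlation theta, 0 < e' &
    forall r, (A `|` B) r -> `|1 + theta r| <= 1 - e'].
Proof.
move=> cphi cpsi e0 e1 phiA psiB.
have [M M0 phiM] := centered_correlation_bounded cphi.
have [N N0 psiN] := centered_correlation_bounded cpsi.
(* One k serves both A and B: 4 M k and 4 N k are at most e, and the summand 1 together with e <= 1
   yields k <= 1 / 2. *)
pose k := e / (4 * (M + N + 1)).
have MN0 : 0 < 4 * (M + N + 1) by lra.
have k0 : 0 < k by rewrite divr_gt0.
have kE : 4 * ((M + N + 1) * k) = e by rewrite /k; field; lra.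
have k2 : k <= 2^-1.
  have : 0 <= (M + N) * k by rewrite mulr_ge0 ?addr_ge0// ltW.
  by move: kE e1 k0; lra.
have kM : 4 * (M * k) <= e.
  by rewrite -[leRHS]kE; have := mulr_ge0 N0 (ltW k0); lra.
have kN : 4 * (N * k) <= e.
  by rewrite -[leRHS]kE; have := mulr_ge0 M0 (ltW k0); lra.
have [m evm ek] : exists2 m, ~~ odd m & (1 - e) ^+ m <= k.
  by apply: exists_even_exprn_le => //; lra.
pose w r := ((1 + phi r) ^+ m * psi r + k * psi r) +
            ((1 + psi r) ^+ m * phi r + k * phi r).
have cw : centered_correlation w.
  by apply: centered_correlationD; apply: centered_correlationD;
    (apply: centered_correlationZ || apply: centered_correlation_exprM) => //;
    exact: ltW.
have [W W0 wW] := centered_correlation_bounded cw.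
have W1 : 0 < W + 1 by lra.
exists (fun r => (W + 1)^-1 * w r), ((W + 1)^-1 * (e * k)); split.
- by apply: centered_correlationZ => //; rewrite invr_ge0 ltW.
- by rewrite mulr_gt0 ?invr_gt0// mulr_gt0.
move=> r ABr; have wr : w r <= - (e * k).
  rewrite /w; case: ABr => [/phiA Ar|/psiB Br].
    by have := combination_neg evm e0 k0 k2 kN Ar ek (psiN r); lra.
  by have := combination_neg evm e0 k0 k2 kM Br ek (phiM r); lra.
have s1 : - 1 <= (W + 1)^-1 * w r.
  rewrite mulrC ler_pdivlMr// mulN1r lerNl (le_trans (ler_norm _))// normrN.
  by rewrite (le_trans (wW r))// lerDl.
have s2 : (W + 1)^-1 * w r <= - ((W + 1)^-1 * (e * k)).
  by rewrite -mulrN ler_wpM2l// invr_ge0 ltW.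
by rewrite ger0_norm; lra.
Qed.

End combination.

(** * Nice vdC sets *)

Section truncation.
Context {R : realType} d (X : measurableType d) (mu : probability X R).

Lemma ae_bounded_measurable (f : X -> R) (M : R) :
  measurable_fun setT f -> {ae mu, forall x, `|f x| <= M} ->
  exists2 u, bounded_measurable u & {ae mu, forall x, f x = u x}.
Proof.
(* Truncation to the interval from [- |M|] to [|M|], which is nonempty whatever the sign of M. *)
move=> mf fM; exists (fun x => Num.max (- `|M|) (Num.min `|M| (f x))).
  split.
    apply: measurable_maxr; first exact: measurable_cst.
    by apply: measurable_minr => //; exact: measurable_cst.
  exists `|M| => x.
  rewrite ler_norml le_max lexx ge_max ge_min lexx !andbT.
  by move: (normr_ge0 M); lra.
apply: filterS fM => x fxM.
have := le_trans fxM (ler_norm M); rewrite ler_norml => /andP[h1 h2].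
by rewrite (min_idPr h2) (max_idPr h1).
Qed.

End truncation.

Section nice_vdC_correlation.
Context {R : realType} {G : groupType}.
Implicit Types (S : set G) (phi : G -> R).

(** The function 1 + f has mean 1 and correlation [1 + phi]. With tolerance e / 2, niceness would
    give some r in S with |1 + phi r| >= 1 - e / 2. *)
Lemma correlation_not_nice_vdC S phi (e : R) : centered_correlation phi ->
  0 < e -> (forall r, S r -> `|1 + phi r| <= 1 - e) -> ~ nice_vdC R S.
Proof.
move=> [d [X [mu [T [f [mT bf f0 phiE]]]]]] e0 phiS nS.
have bc : bounded_measurable (fun _ : X => 1 : R) := bounded_measurable_cst _.
have b1f := bounded_measurableD bc bf.
have [m1f [M fM]] := b1f.
have [] := nS d X mu T (fun x => ((1 + f x)%:C)%C) (e / 2) mT.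
- split; [exact: m1f|exact: (measurable_cst (0 : R))|].
  + apply: (@le_lt_trans _ _ M%:E); last exact: ltry.
    apply/ess_supP/nearW => x.
    by rewrite lee_fin normc_def /= expr0n addr0 sqrtr_sqr.
- by rewrite divr_gt0.
move=> r Sr; rewrite /integral_complex /= [X in `|X| ^+ 2](_ : _ = 1);
    last first.
  congr Complex; last exact: probability_Rintegral_cst.
  by rewrite bounded_RintegralD// f0 addr0 probability_Rintegral_cst.
rewrite [X in _ <= `|X|](_ : _ = ((1 + phi r)%:C)%C); last first.
  congr Complex; last first.
    rewrite -[RHS](probability_Rintegral_cst mu).
    by congr Rintegral; apply/funext => x; ring.
  transitivity (\int[mu]_x
     ((1 + f x) + (f (T r^-1%g x) + f (T r^-1%g x) * f x))).
    by congr Rintegral; apply/funext => x; ring.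
  have bfT := bounded_measurable_act r^-1%g mT.2 bf.
  have bff := bounded_measurableM bfT bf.
  rewrite bounded_RintegralD//; last exact: bounded_measurableD.
  rewrite !bounded_RintegralD// -phiE (Rintegral_act _ mT.2 bf) f0.
  by rewrite probability_Rintegral_cst addr0 add0r.
rewrite normr1 expr1n [X in _ <= X]normc_def /= expr0n addr0 sqrtr_sqr.
rewrite -[1](rmorph1 (real_complex R)) -rmorphB lecR => h.
by have := phiS _ Sr; lra.
Qed.

(** A function violating niceness splits into real and imaginary parts. Their centered correlations
    add up to the real part of the complex correlation minus [a], the squared modulus of the mean;
    dividing by [a] normalizes. *)
Lemma not_nice_vdC_correlation S : ~ nice_vdC R S ->
  exists phi (e : R), [/\ centered_correlation phi, 0 < e &
    forall r, S r -> `|1 + phi r| <= 1 - e].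
Proof.
move=> nS; apply: contrapT => nphi; apply: nS.
move=> d X mu T f eps mT [mRe mIm fM] eps0.
apply: contrapT => nr; apply: nphi.
have [M {}fM] := ess_supr_bounded fM.
have [u bu fu] : exists2 u, bounded_measurable u &
    {ae mu, forall x, complex.Re (f x) = u x}.
  apply: (@ae_bounded_measurable _ _ _ _ _ M) => //.
  apply: filterS fM => x; apply: le_trans; rewrite normc_def /=.
  by rewrite -sqrtr_sqr ler_wsqrtr// lerDl sqr_ge0.
have [v bv fv] : exists2 v, bounded_measurable v &
    {ae mu, forall x, complex.Im (f x) = v x}.
  apply: (@ae_bounded_measurable _ _ _ _ _ M) => //.
  apply: filterS fM => x; apply: le_trans; rewrite normc_def /=.
  by rewrite -sqrtr_sqr ler_wsqrtr// lerDr sqr_ge0.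
have [mu_ _] := bu; have [mv_ _] := bv.
set p := \int[mu]_x u x; set q := \int[mu]_x v x.
have intf : integral_complex mu f = Complex p q.
  by congr Complex; apply: ae_eq_Rintegral.
pose a := p ^+ 2 + q ^+ 2.
have a0 : 0 <= a by rewrite addr_ge0 ?sqr_ge0.
pose phi r := (\int[mu]_x (u (T r^-1%g x) * u x) - p ^+ 2) +
              (\int[mu]_x (v (T r^-1%g x) * v x) - q ^+ 2).
have cphi : centered_correlation phi.
  by apply: centered_correlationD; exact: centered_correlation_center.
(* Otherwise r would satisfy the niceness inequality, since a complex number has modulus at least
   that of its real part, here [a + phi r]. *)
have phiS r : S r -> `|a + phi r| < a - eps.
  move=> Sr; rewrite ltNge; apply/negP => h; apply: nr; exists r => //.
  rewrite intf -add_Re2_Im2 /= -/a -rmorphB.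
  apply: le_trans (normc_ge_Re _); rewrite lecR.
  apply: le_trans h _; rewrite [leRHS]/= /phi.
  have bfT w := @bounded_measurable_act R G d X mu T r^-1%g w mT.2.
  have bT w bw := bounded_measurableM (bfT w bw) bw.
  rewrite le_eqVlt; apply/orP; left; apply/eqP; congr `|_|.
  (* The real part of [z * conjc z'] is Re z Re z' + Im z Im z', and u, v agree almost everywhere
     with the two parts of f, also after translation. *)
  transitivity (\int[mu]_x (u (T r^-1%g x) * u x + v (T r^-1%g x) * v x)).
    by rewrite bounded_RintegralD; [rewrite /a; ring|exact: bT|exact: bT].
  transitivity (\int[mu]_x
     (complex.Re (f (T r^-1%g x)) * complex.Re (f x) +
      complex.Im (f (T r^-1%g x)) * complex.Im (f x))).
    have [_ _ /(_ r^-1%g) mTr _] := mT.2.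
    apply: ae_eq_Rintegral.
    - by case: (bounded_measurableD (bT _ bu) (bT _ bv)).
    - apply: measurable_funD; apply: measurable_funM => //.
        exact: measurableT_comp mRe mTr.
      exact: measurableT_comp mIm mTr.
    - have fuT := ae_act r^-1%g mT.2 fu; have fvT := ae_act r^-1%g mT.2 fv.
      near=> x.
      have -> : complex.Re (f x) = u x by near: x.
      have -> : complex.Im (f x) = v x by near: x.
      have -> : complex.Re (f (T r^-1%g x)) = u (T r^-1%g x) by near: x.
      by have -> : complex.Im (f (T r^-1%g x)) = v (T r^-1%g x) by near: x.
  congr Rintegral; apply/funext => x.
  by case: (f (T _ x)) (f x) => [b c] [b' c'] /=; ring.
case: (ltP 0 a) => [a_gt0|a_le0].
  exists (fun r => a^-1 * phi r), (a^-1 * eps); split.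
  - by apply: centered_correlationZ => //; rewrite invr_ge0.
  - by rewrite mulr_gt0// invr_gt0.
  move=> r /phiS/ltW; rewrite -(ler_pM2l (_ : 0 < a^-1)) ?invr_gt0//.
  rewrite -{1}(@ger0_norm _ a^-1) ?invr_ge0// -normrM mulrDr mulrBr.
  by rewrite mulVf// gt_eqF.
(* If [a <= 0], then [phiS] bounds an absolute value by a negative number, so S is empty and the
   zero correlation will do. *)
exists (fun r => 0 * phi r), 1; split => //.
- exact: centered_correlationZ.
- by move=> r /phiS; have := normr_ge0 (a + phi r); lra.
Unshelve. all: by end_near. Qed.

End nice_vdC_correlation.

Theorem theorem3p3 (R : realType) (G : groupType)
    (G_countable : countable [set: G]) (G_infinite : infinite_set [set: G])
    (A B : set G) :
  ~ nice_vdC R A -> ~ nice_vdC R B -> ~ nice_vdC R (A `|` B).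
Proof.
move=> /not_nice_vdC_correlation[phi [a [cphi a0 phiA]]].
move=> /not_nice_vdC_correlation[psi [b [cpsi b0 psiB]]].
(* A common gap for both sets, capped at 1 so that 1 - e is nonnegative and its powers tend to 0. *)
pose e : R := Num.min (Num.min a b) 1.
have e0 : 0 < e by rewrite !lt_min a0 b0 ltr01.
have ea : e <= a by rewrite !ge_min lexx.
have eb : e <= b by rewrite !ge_min lexx orbT.
have e1 : e <= 1 by rewrite ge_min lexx orbT.
have [theta [e' [ctheta e'0 thetaAB]]] :
    exists theta (e' : R), [/\ centered_correlation theta, 0 < e' &
      forall r, (A `|` B) r -> `|1 + theta r| <= 1 - e'].
  apply: (centered_correlation_union cphi cpsi e0 e1) => r.
    by move=> /phiA Ar; apply: le_trans Ar _; rewrite lerB.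
  by move=> /psiB Br; apply: le_trans Br _; rewrite lerB.
exact: correlation_not_nice_vdC ctheta e'0 thetaAB.
Qed.
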